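(* If the flow $(X,T)$ is strongly rigid, then every $A\in 2^X$ is a recurrent point of the induced flow $(2^X,T)$.
   Context: A flow $(X,T)$ is an action $(t,x)\mapsto tx$ of an infinite discrete (not necessarily abelian) group $T$ by homeomorphisms on a compact, infinite metric space $(X,d)$; each $t\in T$ is identified with the map $x\mapsto tx$, and $e\in T$ is the identity. The enveloping semigroup $E(X)$ is the closure of $T$ in $X^X$ with the product (point-open) topology; it is a semigroup under composition. A nonempty $I\subset E(X)$ is a left ideal if $E(X)\cdot I\subset I$; a minimal ideal is a closed left ideal containing no left ideal as a proper subset. A minimal idempotent is an idempotent belonging to a minimal ideal. The flow is strongly rigid if every minimal idempotent $u\in E(X)$ is an accumulation point in $E(X)$ endowed with the compact-open topology, i.e. there is a (non-trivial) net $\{t_k\}$ in $T$ with $t_k\to u$ uniformly on $X$; non-trivial means $t_k\neq u$ for all $k$, and in particular, when $u=e$, no $t_k$ is the identity element of $T$. A point $x$ of a flow $(X,T)$ is recurrent if it is an accumulation point of its orbit $Tx=\{tx:t\in T\}$, the orbit being regarded as a family indexed by $T$: for every neighborhood $U$ of $x$ there is $t\in T$, $t\ne e$, with $tx\in U$. $2^X$ is the compact metric space of nonempty closed subsets of $X$ with the Hausdorff metric $d_H$; the induced flow $(2^X,T)$ is given by $tA=\{ta:a\in A\}$. *)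

(* Defs.v *)
From HB Require Import structures.
From mathcomp Require Import all_boot all_order all_algebra.
From mathcomp Require Import all_classical all_reals all_analysis.

Set Implicit Arguments.
Unset Strict Implicit.
Unset Printing Implicit Defensive.

Import Order.TTheory GRing.Theory Num.Theory.

Local Open Scope classical_set_scope.
Local Open Scope ring_scope.

(* Left actions of a discrete group by homeomorphisms; the inverse of
   [act s] is [act s^-1], so continuity of every [act s] suffices. *)
Record flow (T : groupType) (X : topologicalType) := Flow {
  act : T -> X -> X;
  act1 : forall x, act 1%g x = x;
  actM : forall s t x, act (s * t)%g x = act s (act t x);
  act_continuous : forall t, continuous (act t)
}.

Section flow_theory.
Context (T : groupType) (X : topologicalType) (F : flow T X).

Lemma actK t : cancel (act F t) (act F t^-1%g).
Proof. by move=> x; rewrite -actM mulVg act1. Qed.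

Lemma actVK t : cancel (act F t^-1%g) (act F t).
Proof. by move=> x; rewrite -actM mulgV act1. Qed.

Lemma closed_act_image t (A : set X) : closed A -> closed (act F t @` A).
Proof.
have -> : act F t @` A = act F t^-1%g @^-1` A.
  apply/seteqP; split=> [_ [x Ax <-]|x Ax] /=; first by rewrite actK.
  by exists (act F t^-1%g x) => //; rewrite actVK.
by apply: preimage_closed => x _; exact: act_continuous.
Qed.

Definition enveloping_semigroup : set (X -> X) :=
  closure (range (act F) : set {ptws X -> X}).

Definition left_ideal (I : set (X -> X)) : Prop :=
  [/\ I !=set0, I `<=` enveloping_semigroup &
      forall p q, enveloping_semigroup p -> I q -> I (p \o q)].

Definition minimal_ideal (I : set (X -> X)) : Prop :=
  [/\ left_ideal I, closed (I : set {ptws X -> X}) &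
      forall J, left_ideal J -> ~ (J `<` I)].

Definition minimal_idempotent (u : X -> X) : Prop :=
  u \o u = u /\ exists2 I, minimal_ideal I & I u.

(* The orbit of [x] is regarded as a family indexed by [T]: [x] returns at
   some group element other than the identity, possibly with [act F t x = x]. *)
Definition recurrent (x : X) : Prop :=
  forall U, nbhs x U -> exists2 t, t != 1%g & U (act F t x).

End flow_theory.

(* [u] is an accumulation point, for uniform convergence on [X], of the set of
   the maps [act F t]; see [strongly_rigid_net] for the formulation by nets. *)
Definition strongly_rigid (R : realType) (T : groupType) (X : metricType R)
    (F : flow T X) : Prop :=
  forall u, minimal_idempotent F u ->
    limit_point (range (act F) : set {uniform X -> X}) u.

Lemma strongly_rigid_net (R : realType) (T : groupType) (X : metricType R)
    (F : flow T X) :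
  strongly_rigid F <->
  forall u, minimal_idempotent F u ->
    exists (K : Type) (le : K -> K -> Prop) (t : K -> T),
      [/\ inhabited K, (forall k, le k k),
          (forall i j k, le i j -> le j k -> le i k) &
          (forall i j, exists2 k, le i k & le j k)] /\
      (forall k, act F (t k) <> u) /\
      (forall e : R, 0 < e -> exists k0, forall k, le k0 k ->
         forall x, mdist (u x) (act F (t k) x) < e).
Proof.
split=> SR u /SR.
  move=> lu.
  have nt (e : {posnum R}) :
      exists t, act F t <> u /\ forall x, mdist (u x) (act F t x) < e%:num.
    have [|y [/eqP yu [t _ ty] uy]] :=
        lu [set h | forall x, mdist (u x) (h x) < e%:num].
      apply/uniform_nbhs; exists [set xy | ball xy.1 e%:num xy.2]; split.
        exact: entourage_ball.
      by move=> h /= H x; have := H x I; rewrite ballEmdist.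
    by exists t; rewrite ty.
  have {}[t tP] := choice nt.
  exists {posnum R}, (fun e e' => e'%:num <= e%:num), t; split; last split.
  - split; first by [split; exact: 1%:pos].
    + by move=> k; exact: lexx.
    + by move=> i j k ij jk; exact: le_trans jk ij.
    + move=> i j; have [ij|/ltW ji] := leP i%:num j%:num.
        by exists i.
      by exists j.
  - by move=> k; have [] := tP k.
  - move=> e e0; exists (PosNum e0) => k ke x.
    by have [_ /(_ x) h] := tP k; exact: lt_le_trans h ke.
move=> [K [le [t [[_ leK _ _] [tu tcvg]]]]] U /uniform_nbhs[E [entE EU]].
move: entE; rewrite -entourage_ballE => -[e /= e0 eE].
have [k0 /(_ _ (leK k0)) k0e] := tcvg e e0.
exists (act F (t k0)); split; first exact/eqP/tu.
  by exists (t k0).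
by apply: EU => x _; apply: eE => /=; rewrite ballEmdist; exact: k0e.
Qed.

Section hausdorff_distance.
Context (R : realType) (X : metricType R).
Implicit Types (A B C : set X) (x y : X).

Definition dist_to x A : R := inf [set mdist x a | a in A].

Definition hausdorff_dist A B : R :=
  Num.max (sup [set dist_to a B | a in A]) (sup [set dist_to b A | b in B]).

Lemma hausdorff_distC A B : hausdorff_dist A B = hausdorff_dist B A.
Proof. by rewrite /hausdorff_dist maxC. Qed.

Lemma dist_to_le x A a : A a -> dist_to x A <= mdist x a.
Proof.
move=> Aa; apply: ge_inf; last by exists a.
by exists 0 => _ [y _ <-]; exact: mdist_ge0.
Qed.

Lemma dist_to_ge x A e : A !=set0 -> (forall a, A a -> e <= mdist x a) ->
  e <= dist_to x A.
Proof.
move=> [a0 Aa0] H; apply: lb_le_inf; first by exists (mdist x a0), a0.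
by move=> _ [a Aa <-]; exact: H.
Qed.

Lemma dist_to_triangle x y A : A !=set0 ->
  dist_to x A <= mdist x y + dist_to y A.
Proof.
move=> A0; rewrite -lerBlDl; apply: dist_to_ge => // a Aa.
rewrite lerBlDl; apply: le_trans (metric_triangle x y a).
exact: dist_to_le.
Qed.

Lemma dist_to_lt x A e : A !=set0 -> dist_to x A < e ->
  exists2 a, A a & mdist x a < e.
Proof.
move=> A0 xAe; apply: contrapT => H; have := xAe; rewrite ltNge.
move=> /negP; apply; apply: dist_to_ge => // a Aa; rewrite leNgt.
by apply/negP => ae; apply: H; exists a.
Qed.

Lemma hausdorff_dist_le A B e : A !=set0 -> B !=set0 ->
  (forall a, A a -> dist_to a B <= e) ->
  (forall b, B b -> dist_to b A <= e) -> hausdorff_dist A B <= e.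
Proof.
move=> [a0 Aa0] [b0 Bb0] AB BA; rewrite /hausdorff_dist ge_max; apply/andP; split.
  apply: ge_sup; first by exists (dist_to a0 B), a0.
  by move=> _ [a Aa <-]; exact: AB.
apply: ge_sup; first by exists (dist_to b0 A), b0.
by move=> _ [b Bb <-]; exact: BA.
Qed.

Hypothesis cX : compact [set: X].

Lemma compact_mdist_bounded x0 : exists M : R, forall x, mdist x0 x <= M.
Proof.
have /compact_near_coveringP/(_ nat \oo (fun n x => mdist x0 x <= n%:R)) := cX.
case=> [x _|N _ /(_ N (leqnn N)) H]; last first.
  by exists N%:R => x; exact: H.
exists (ball x 1, [set n | mdist x0 x + 1 <= n%:R]).
  split; first exact: nbhsx_ballx.
  exact: nbhs_infty_ger.
move=> [y n] /= []; rewrite ballEmdist /= => /ltW xy; apply: le_trans.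
by apply: le_trans (metric_triangle x0 x y) _; rewrite lerD2l.
Qed.

Lemma le_hausdorff_dist A B a : A a -> B !=set0 ->
  dist_to a B <= hausdorff_dist A B.
Proof.
move=> Aa [b Bb]; rewrite /hausdorff_dist le_max; apply/orP; left.
apply: ub_le_sup; last by exists a.
have [M HM] := compact_mdist_bounded b; exists M => _ [x _ <-].
by apply: le_trans (dist_to_le x Bb) _; rewrite metric_sym.
Qed.

Lemma hausdorff_dist_triangle B A C : A !=set0 -> B !=set0 -> C !=set0 ->
  hausdorff_dist A C <= hausdorff_dist A B + hausdorff_dist B C.
Proof.
move=> A0 B0 C0.
have half A' C' : A' !=set0 -> C' !=set0 -> forall a, A' a ->
    dist_to a C' <= hausdorff_dist A' B + hausdorff_dist B C'.
  move=> A'0 C'0 a Aa; rewrite -lerBlDr.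
  apply: le_trans (le_hausdorff_dist Aa B0); apply: dist_to_ge => // b Bb.
  rewrite lerBlDr; apply: le_trans (dist_to_triangle a b C'0) _.
  by rewrite lerD2l; exact: le_hausdorff_dist.
apply: hausdorff_dist_le => //; first exact: half.
move=> c Cc; rewrite addrC [hausdorff_dist B C]hausdorff_distC.
by rewrite [hausdorff_dist A B]hausdorff_distC; exact: half.
Qed.

Lemma hausdorff_distxx A : A !=set0 -> hausdorff_dist A A = 0.
Proof.
move=> A0; have dA a : A a -> dist_to a A <= 0.
  by move=> Aa; rewrite -(mdistxx a); exact: dist_to_le.
apply/eqP; rewrite eq_le hausdorff_dist_le//=.
have [a Aa] := A0; apply: le_trans (le_hausdorff_dist Aa A0).
by apply: dist_to_ge => // b _; exact: mdist_ge0.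
Qed.

Lemma hausdorff_dist0_sub A B : A !=set0 -> B !=set0 -> closed B ->
  hausdorff_dist A B = 0 -> A `<=` B.
Proof.
move=> A0 B0 clB AB0 a Aa; apply: clB => U.
rewrite -nbhs_ballE => -[e /= e0 eU].
have [|b Bb abe] := @dist_to_lt a B e B0.
  by apply: le_lt_trans e0; rewrite -AB0; exact: le_hausdorff_dist.
by exists b; split=> //; apply: eU; rewrite ballEmdist.
Qed.

End hausdorff_distance.

(* 2^X; compactness of [X] is an argument of the type because the Hausdorff
   distance is finite, hence a metric, only on bounded sets. *)
Record hyperspace (R : realType) (X : metricType R)
    (cX : compact [set: X]) := Hyperspace {
  hset :> set X;
  hset_nonempty : hset !=set0;
  hset_closed : closed hset
}.

Lemma hset_inj (R : realType) (X : metricType R) (cX : compact [set: X]) :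
  injective (@hset R X cX).
Proof.
move=> [A A0 clA] [B B0 clB] /= AB; move: A0 clA; rewrite {}AB => A0 clA.
by congr Hyperspace; exact: Prop_irrelevance.
Qed.

Section hyperspace_metric.
Context (R : realType) (X : metricType R) (cX : compact [set: X]).

HB.instance Definition _ := gen_eqMixin (hyperspace cX).
HB.instance Definition _ := gen_choiceMixin (hyperspace cX).

Let hdist (A B : hyperspace cX) : R := hausdorff_dist A B.

Let hdistxx A : hdist A A = 0.
Proof. by apply: hausdorff_distxx => //; exact: hset_nonempty. Qed.

Let hdist_positivity A B : hdist A B = 0 -> A = B.
Proof.
move=> AB; apply/hset_inj/seteqP; split.
  by apply: hausdorff_dist0_sub AB => //;
    [exact: hset_nonempty|exact: hset_nonempty|exact: hset_closed].
move: AB; rewrite /hdist hausdorff_distC => AB.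
by apply: hausdorff_dist0_sub AB => //;
  [exact: hset_nonempty|exact: hset_nonempty|exact: hset_closed].
Qed.

Let hdistC A B : hdist A B = hdist B A.
Proof. exact: hausdorff_distC. Qed.

Let hdist_triangle B A C : hdist A C <= hdist A B + hdist B C.
Proof.
by apply: hausdorff_dist_triangle => //; exact: hset_nonempty.
Qed.

HB.instance Definition _ := @isMetric.Build R (hyperspace cX)
  hdist hdistxx hdist_positivity hdistC hdist_triangle.

Lemma hyperspace_mdistE (A B : hyperspace cX) :
  mdist A B = hausdorff_dist A B.
Proof. by []. Qed.

End hyperspace_metric.

Section induced_flow.
Context (R : realType) (T : groupType) (X : metricType R).
Context (cX : compact [set: X]) (F : flow T X).

Definition induced_act (t : T) (A : hyperspace cX) : hyperspace cX :=
  @Hyperspace R X cX (act F t @` A)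
    (image_nonempty (act F t) (hset_nonempty A))
    (closed_act_image (F := F) (t := t) (@hset_closed R X cX A)).

Lemma induced_act1 A : induced_act 1%g A = A.
Proof.
apply: hset_inj; apply/seteqP; split=> [_ [x Ax <-]|x Ax] /=.
  by rewrite act1.
by exists x => //; rewrite act1.
Qed.

Lemma induced_actM s t A :
  induced_act (s * t)%g A = induced_act s (induced_act t A).
Proof.
apply: hset_inj; apply/seteqP; split=> [_ [x Ax <-]|_ [_ [x Ax <-] <-]] /=.
  by rewrite actM; exists (act F t x) => //; exists x.
by exists x => //; rewrite actM.
Qed.

Lemma act_unif_continuous t (e : R) : 0 < e ->
  exists2 d : R, 0 < d &
    forall x y, mdist x y < d -> mdist (act F t x) (act F t y) < e.
Proof.
move=> e0.
have /compact_near_coveringP/(_ R 0^'+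
  (fun d x => forall y, mdist x y < d -> mdist (act F t x) (act F t y) < e)) := cX.
case=> [x _|d /= d0 H]; last first.
  have d20 : 0 < d / 2 by rewrite divr_gt0.
  exists (d / 2) => // x y; apply: (H (d / 2)) => //=.
  by rewrite sub0r normrN gtr0_norm// gtr_pMr// invf_lt1// ltr1n.
have e20 : 0 < e / 2 by rewrite divr_gt0.
have : nbhs x (act F t @^-1` ball (act F t x) (e / 2)).
  exact/act_continuous/nbhsx_ballx.
rewrite -nbhs_ballE => -[d /= d0 dH].
have d20 : 0 < d / 2 by rewrite divr_gt0.
exists (ball x (d / 2), [set r | r <= d / 2]).
  by split; [exact: nbhsx_ballx|exact: nbhs_right_le].
move=> [x' r] /= [xx' rd] y x'y.
have bx' : ball x d x' by apply: le_ball xx'; rewrite ler_pdivrMr// ler_pMr// ler1n.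
have by_ : ball x d y.
  rewrite (splitr d); apply: ball_triangle xx' _.
  by rewrite ballEmdist /=; exact: lt_le_trans x'y rd.
have /= := dH _ bx'; have /= := dH _ by_; rewrite !ballEmdist /= => h1 h2.
apply: le_lt_trans (metric_triangle _ (act F t x) _) _.
by rewrite (splitr e) ltrD// metric_sym.
Qed.

Lemma induced_act_continuous t : continuous (induced_act t).
Proof.
move=> A U /nbhs_ballP[e /= e0 eU].
have e20 : 0 < e / 2 by rewrite divr_gt0.
have [d d0 dH] := act_unif_continuous t e20.
apply/nbhs_ballP; exists d => //= B; rewrite ballEmdist /= => ABd.
apply: eU; rewrite ballEmdist /= hyperspace_mdistE.
have half (C D : hyperspace cX) : hausdorff_dist C D < d ->
    forall y, hset (induced_act t C) y -> dist_to y (induced_act t D) <= e / 2.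
  move=> CDd _ [x Cx <-].
  have [|z Dz xz] := @dist_to_lt R X x D d (hset_nonempty D).
    by apply: le_lt_trans CDd; apply: le_hausdorff_dist => //; exact: hset_nonempty.
  have Dtz : hset (induced_act t D) (act F t z) by exists z.
  by apply: le_trans (dist_to_le _ Dtz) _; exact/ltW/dH.
apply: (@le_lt_trans _ _ (e / 2)); last first.
  by rewrite gtr_pMr// invf_lt1// ltr1n.
apply: hausdorff_dist_le; [exact: hset_nonempty|exact: hset_nonempty| |].
  exact: half.
by apply: half; rewrite hausdorff_distC.
Qed.

Definition induced_flow : flow T (hyperspace cX) :=
  Flow induced_act1 induced_actM induced_act_continuous.

End induced_flow.

(* Main.v *)
Require Import Defs.
From mathcomp Require Import all_boot all_order all_algebra.
From mathcomp Require Import all_classical all_reals all_analysis.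
From mathcomp Require Import lra.

Set Implicit Arguments.
Unset Strict Implicit.
Unset Printing Implicit Defensive.

Import Order.TTheory GRing.Theory Num.Theory.

Local Open Scope classical_set_scope.
Local Open Scope ring_scope.

(** The point is that strong rigidity forces the identity map itself to be a
uniform accumulation point of the maps [act F t].

The enveloping semigroup is compact, and composition is continuous in its left
argument, so Ellis's theory of compact right topological semigroups provides a
minimal left ideal with an idempotent [u] in it
([exists_minimal_idempotent]).  By strong rigidity [u] is a uniform limit of
the homeomorphisms [act F t]; it is therefore continuous and has dense range.
The range of an idempotent consists of its fixed points, so [u] fixes a dense
set, and by continuity it is the identity
([idempotent_uniform_limit_id]).

Hence there are maps [act F t], different from the identity, so that [t] is
not the neutral element, which displace every point of [X] by at most a
prescribed [e].  Such a map moves every closed set by at most [e] in the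
Hausdorff distance ([hausdorff_dist_image_le]), and this is the recurrence of
every point of the hyperspace, with the same times [t] for all of them. *)

Lemma compact_chain_bigcap (M : topologicalType) (K : set M)
    (C : set (set M)) :
  compact K -> C !=set0 -> total_on C subset ->
  (forall A, C A -> [/\ A `<=` K, closed A & A !=set0]) ->
  \bigcap_(A in C) A !=set0.
Proof.
move=> cK C0 totC CP.
have FC : Filter (filter_from C id).
  apply: filter_from_filter => // A B CA CB.
  by have [AB|BA] := totC _ _ CA CB; [exists A|exists B] => // x; split; auto.
have PC : ProperFilter (filter_from C id).
  by apply: filter_from_proper => A /CP[].
have [|p [_ clp]] := cK _ PC; first by have [A CA] := C0; exists A; have [] := CP A.
exists p => A CA; have [_ clA _] := CP A CA.
by apply: clA => U; apply: clp; exists A.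
Qed.

(** Zorn's lemma in the form used by Ellis's theory.  It serves once for
subsemigroups and once for left ideals: both are closure conditions [Q] that
pass to arbitrary intersections, while compactness keeps the intersection of
a chain nonempty. *)
Lemma exists_minimal_closed (M : topologicalType) (K : set M)
    (Q : set M -> Prop) :
  compact K -> closed K -> K !=set0 -> Q K ->
  (forall C : set (set M), C `<=` Q -> Q (\bigcap_(A in C) A)) ->
  exists I, [/\ I `<=` K, closed I, I !=set0, Q I &
    forall J, J `<=` I -> closed J -> J !=set0 -> Q J -> J = I].
Proof.
move=> cK clK K0 QK Qcap.
(* Zorn's lemma is applied to increasing unions, hence to the sets removed
   from K. *)
pose P := [set B | [/\ closed (K `\` B), (K `\` B) !=set0 & Q (K `\` B)]].
have [F FP totF|B [[clB B0 QB] Bmax]] := @Zorn_bigcup M P.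
  (* K is added to the chain of differences because the chain F may be empty. *)
  pose C := [set A | A = K \/ exists2 B, F B & A = K `\` B].
  have CP A : C A -> [/\ A `<=` K, closed A, A !=set0 & Q A].
    by move=> [->|[B /FP[? ? ?] ->]]; split.
  have totC : total_on C subset.
    move=> _ _ [->|[B FB ->]] [->|[B' FB' ->]]; try by [left|right|left=> ? []|right=> ? []].
    by have [BB'|B'B] := totF _ _ FB FB'; [right|left] => x [Kx nx]; split=> //;
      apply: contra_not nx; auto.
  have -> : P (\bigcup_(X in F) X) = [/\ closed (\bigcap_(A in C) A),
      \bigcap_(A in C) A !=set0 & Q (\bigcap_(A in C) A)].
    rewrite /P /=; suff -> : K `\` \bigcup_(X in F) X = \bigcap_(A in C) A by [].
    apply/seteqP; split=> [x [Kx nFx] _ [->//|[B FB ->]]|x Cx].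
      by split=> // Bx; apply: nFx; exists B.
    split=> [|[B FB Bx]]; first by apply: Cx; left.
    by have [] : (K `\` B) x by apply: Cx; right; exists B.
  split; first by apply: closed_bigI => A /CP[].
    apply: (compact_chain_bigcap cK) => //; first by exists K; left.
    by move=> A /CP[].
  by apply: Qcap => A /CP[].
exists (K `\` B); split=> //.
move=> J JI clJ J0 QJ; have JE : K `\` ~` J = J.
  by rewrite setDE setCK; apply/setIidPr => x /JI[].
apply/seteqP; split=> // x [Kx nBx]; apply: contrapT => nJx.
apply: (Bmax (~` J)); last by rewrite /P /= JE.
by split=> [y By /JI[]//|/(_ x nJx)].
Qed.

Section compact_right_topological_semigroup.
Context (M : topologicalType) (op : M -> M -> M).
Hypothesis hM : hausdorff_space M.
Hypothesis opA : associative op.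
Hypothesis op_cont : forall q, continuous (op ^~ q).

(** Only right translations are continuous; this is enough to make the left
ideal generated by one element closed. *)
Lemma closed_right_translate (K : set M) q :
  compact K -> closed (op ^~ q @` K).
Proof.
move=> cK; apply: compact_closed => //; apply: continuous_compact => //.
exact/continuous_subspaceT/op_cont.
Qed.

(** Ellis's lemma.  For [u] in a minimal closed subsemigroup [N], the closed
subsemigroup [N u] is all of [N], so [p u = u] has a solution in [N]; the
solutions form again a closed subsemigroup, hence all of [N], and [u] is one
of them. *)
Lemma ellis_idempotent (S : set M) :
  compact S -> S !=set0 -> (forall p q, S p -> S q -> S (op p q)) ->
  exists2 u, S u & op u u = u.
Proof.
move=> cS S0 SS; have clS := compact_closed hM cS.
pose Q A := forall p q, A p -> A q -> A (op p q).
have [|N [NS clN [u Nu] QN Nmin]] :=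
    @exists_minimal_closed M S Q cS clS S0 SS.
  by move=> C CQ p q Cp Cq A CA; apply: CQ => //; [exact: Cp|exact: Cq].
have cN : compact N := subclosed_compact clN cS NS.
have NuE : op ^~ u @` N = N.
  apply: Nmin; [|exact: closed_right_translate|by exists (op u u), u|].
    by move=> _ [p Np <-]; exact: QN.
  move=> _ _ [p Np <-] [q Nq <-]; exists (op (op p u) q); last by rewrite -!opA.
  exact: (QN _ _ (QN _ _ Np Nu) Nq).
have [v Nv vu] : (op ^~ u @` N) u by rewrite NuE.
pose W := N `&` op ^~ u @^-1` [set u].
have WE : W = N.
  apply: Nmin; [exact: subIsetl| |by exists v|].
    apply: closedI => //; apply: preimage_closed; first by move=> x _; exact: op_cont.
    exact: accessible_closed_set1 (hausdorff_accessible hM) u.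
  move=> p q [Np /= pu] [Nq /= qu]; split=> /=; first exact: QN.
  by rewrite -opA qu pu.
exists u; first exact: NS.
by have [] : W u by rewrite WE.
Qed.

(** Minimality among closed left ideals improves to minimality among all left
ideals, because a left ideal containing [q] contains the closed left ideal
[S q]. *)
Lemma exists_minimal_left_ideal (S : set M) :
  compact S -> S !=set0 -> (forall p q, S p -> S q -> S (op p q)) ->
  exists I, [/\ I `<=` S, compact I, I !=set0,
    (forall p q, S p -> I q -> I (op p q)) &
    forall J, J `<=` I -> J !=set0 ->
      (forall p q, S p -> J q -> J (op p q)) -> J = I].
Proof.
move=> cS S0 SS; have clS := compact_closed hM cS.
pose Q A := forall p q, S p -> A q -> A (op p q).
have [|I [IS clI I0 QI Imin]] := @exists_minimal_closed M S Q cS clS S0 SS.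
  by move=> C CQ p q Sp Cq A CA; apply: CQ => //; exact: Cq.
exists I; split=> //; first exact: subclosed_compact clI cS IS.
move=> J JI [q Jq] QJ; apply/seteqP; split=> //.
have -> : I = op ^~ q @` S.
  apply/esym/Imin; [|exact: closed_right_translate| |].
  - by move=> _ [p Sp <-]; apply: QI => //; exact: JI.
  - by have [p Sp] := S0; exists (op p q), p.
  - by move=> p _ Sp [p' Sp' <-]; exists (op p p'); [exact: SS|rewrite -opA].
by move=> _ [p Sp <-]; exact: QJ.
Qed.

End compact_right_topological_semigroup.

Section enveloping_semigroup_theory.
Context (R : realType) (T : groupType) (X : metricType R) (F : flow T X).
Let E : set {ptws X -> X} := enveloping_semigroup F.

Lemma eval_continuous x : continuous (fun p : {ptws X -> X} => p x).
Proof. exact: (@proj_continuous X (fun=> X) x). Qed.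

Lemma continuous_ptws (f : {ptws X -> X} -> {ptws X -> X}) :
  (forall x, continuous (fun p => f p x)) -> continuous f.
Proof.
move=> fx p; have FF : Filter (f @ p) by apply: fmap_filter; apply: nbhs_filter.
by apply/pointwise_cvgP => x; exact: fx.
Qed.

Lemma comp_continuousl (q : X -> X) :
  continuous (fun p : {ptws X -> X} => p \o q : {ptws X -> X}).
Proof. by apply: continuous_ptws => x; exact: eval_continuous. Qed.

Lemma act_comp_continuous t :
  continuous (fun p : {ptws X -> X} => act F t \o p : {ptws X -> X}).
Proof.
apply: continuous_ptws => x p; apply: cvg_comp (@eval_continuous x p) _.
exact: act_continuous.
Qed.

Lemma act_enveloping t : E (act F t).
Proof. by apply: subset_closure; exists t. Qed.

(** A continuous map that sends the group into the closure of the group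
preserves that closure. *)
Lemma enveloping_stable (f : {ptws X -> X} -> {ptws X -> X}) :
  continuous f -> (forall t, E (f (act F t))) -> forall p, E p -> E (f p).
Proof.
move=> fc ft; suff : E `<=` f @^-1` E by [].
rewrite {1}/E /enveloping_semigroup closureE; apply: smallest_sub.
  by apply: preimage_closed => [p _|]; [exact: fc|exact: closed_closure].
by move=> _ [t _ <-]; exact: ft.
Qed.

(** Two successive closure arguments: [act F t \o q] lies in the enveloping
semigroup because composition with the continuous map [act F t] on the left is
continuous, and then [p \o q] does because composition with an arbitrary [q]
on the right is continuous. *)
Lemma enveloping_comp p q : E p -> E q -> E (p \o q).
Proof.
move=> Ep Eq; apply: (enveloping_stable (comp_continuousl (q := q))) Ep => t.
apply: (enveloping_stable (act_comp_continuous (t := t))) Eq => s.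
rewrite (_ : _ \o _ = act F (t * s)%g); first exact: act_enveloping.
by apply/funext => x; rewrite /= actM.
Qed.

Lemma enveloping_compact : compact [set: X] -> compact E.
Proof.
move=> cX; apply: (@subclosed_compact _ _ [set f : {ptws X -> X} | forall x, setT (f x)]).
- exact: closed_closure.
- exact: (@tychonoff X (fun=> X) (fun=> setT)).
- by [].
Qed.

Lemma exists_minimal_idempotent :
  compact [set: X] -> exists u, minimal_idempotent F u.
Proof.
move=> /enveloping_compact cE.
have hM : hausdorff_space {ptws X -> X}.
  by apply: hausdorff_product => _; exact: metric_hausdorff.
pose op (p q : {ptws X -> X}) : {ptws X -> X} := p \o q.
have opA : associative op by [].
have E0 : E !=set0 by exists (act F 1%g); exact: act_enveloping.
have [I [IE cI I0 QI Imin]] := exists_minimal_left_ideal hM opA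
  comp_continuousl cE E0 enveloping_comp.
have [|u Iu uu] := ellis_idempotent hM opA comp_continuousl cI I0.
  by move=> p q /IE Ep; exact: QI.
exists u; split=> //; exists I => //; split=> //.
  exact: compact_closed.
move=> J [J0 JE QJ] [JI]; apply.
by rewrite (Imin J).
Qed.

End enveloping_semigroup_theory.

(** The map [u] is continuous as a uniform limit, and its range is dense because
the approximating maps are onto; it fixes its range pointwise.  The proof makes
this quantitative: [z] is a fixed point of [u] near [x], and [u x] is compared
with [x] through [act F t x], [act F t z] and [z]. *)
Lemma idempotent_uniform_limit_id (R : realType) (T : groupType)
    (X : metricType R) (F : flow T X) (u : X -> X) :
  u \o u = u ->
  (forall e : R, 0 < e -> exists t, forall x, mdist (u x) (act F t x) < e) ->
  u = id.
Proof.
move=> uu ut; apply/funext => x; apply: mdist_positivity.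
apply/eqP; rewrite eq_le mdist_ge0 andbT; apply/ler_addgt0Pr => e e0; rewrite add0r.
have e40 : 0 < e / 4 by rewrite divr_gt0.
(* The map [act F t] approximates u and witnesses its continuity at x. *)
have [t tP] := ut _ e40.
have : nbhs x (act F t @^-1` ball (act F t x) (e / 4)).
  exact/act_continuous/nbhsx_ballx.
rewrite -nbhs_ballE => -[d /= d0 dH].
have m0 : 0 < Num.min d (e / 4) by rewrite lt_min d0.
have [s sP] := ut _ m0.
(* As [act F s] sends [act F s^-1 x] to x, its approximant u sends that point
   near x. *)
pose z := u (act F s^-1%g x).
have uz : u z = z by rewrite -[LHS]/((u \o u) _) uu.
have := sP (act F s^-1%g x); rewrite actVK -/z lt_min => /andP[zxd zxe].
have := dH z; rewrite !ballEmdist /= metric_sym => /(_ zxd) txz.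
have h1 := tP x; have h2 := tP z; rewrite uz metric_sym in h2.
have := metric_triangle (u x) (act F t x) x.
have := metric_triangle (act F t x) (act F t z) x.
have := metric_triangle (act F t z) z x.
lra.
Qed.

Lemma hausdorff_dist_image_le (R : realType) (X : metricType R) (f : X -> X)
    (A : set X) (e : R) : A !=set0 ->
  (forall x, mdist x (f x) <= e) -> hausdorff_dist A (f @` A) <= e.
Proof.
move=> A0 fe; apply: hausdorff_dist_le => //; first exact: image_nonempty.
  by move=> a Aa; apply: le_trans (fe a); apply: dist_to_le; exists a.
move=> _ [a Aa <-]; apply: le_trans (fe a); rewrite metric_sym.
exact: dist_to_le.
Qed.

Theorem proposition2p26 (R : realType) (T : groupType) (X : metricType R)
    (cX : compact [set: X]) (F : flow T X) :
  infinite_set [set: T] -> infinite_set [set: X] ->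
  strongly_rigid F ->
  forall A : hyperspace cX, recurrent (induced_flow cX F) A.
Proof.
move=> _ _ /strongly_rigid_net srF A U /nbhs_ballP[e /= e0 eU].
have [u uP] := exists_minimal_idempotent F cX.
have [K [le [t [[_ le_refl _ _] [tu tcvg]]]]] := srF u uP.
have uid : u = id.
  apply: (@idempotent_uniform_limit_id _ _ _ F); first by case: uP.
  by move=> r /tcvg[k kP]; exists (t k); exact: kP (le_refl k).
have [k kP] := tcvg (e / 2) (divr_gt0 e0 (ltr0n _ 2)).
exists (t k).
  apply/eqP => tk1; apply: (tu k); rewrite tk1 uid.
  by apply/funext => x; rewrite act1.
apply: eU; rewrite ballEmdist /= hyperspace_mdistE.
apply: (@le_lt_trans _ _ (e / 2)); last by rewrite gtr_pMr// invf_lt1// ltr1n.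
apply: hausdorff_dist_image_le; first exact: hset_nonempty.
by move=> x; have := kP k (le_refl k) x; rewrite uid => /ltW.
Qed.
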